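(* Let $G$ be a topological group, let $\mathbb{G}=\mathrm{Aut}(\mathrm{M}(G))$ carry the tau-topology, fix $w\in\mathrm{M}(G)$, let $O$ be the set of open neighborhoods of $w$ in $\mathrm{M}(G)$ directed by reverse inclusion, and let $\mathcal{V}$ be a cofinal ultrafilter on $O$. Fix a set $I$, an ultrafilter $\mathcal{U}\in\beta I$, and $(p_i)_{i\in I}\in\mathbb{G}^I$. Given $A\in O$ and $i\in I$, define $p_{A,i}:=p_i$. Then for $p\in\mathbb{G}$, we have $p\in\lim_{\mathcal{U}}p_i$ if and only if for some minimal subflow $M\subseteq\Sigma^G_{\mathcal{V}\otimes\mathcal{U}}\mathrm{M}(G)$ we have $p=\lim_Mp_{A,i}$.
   Context: All topological groups and flows are Hausdorff. A $G$-flow is a compact space with a continuous left $G$-action $G\times X\to X$; it is minimal if every orbit is dense. A $G$-map is a continuous $G$-equivariant map. $\mathrm{M}(G)$ is the universal minimal flow: the (unique up to isomorphism) minimal $G$-flow admitting a $G$-map onto every minimal $G$-flow. $\mathrm{Aut}(\mathrm{M}(G))$ is the group of $G$-flow automorphisms. Tau-topology on $\mathbb{G}$: for $S\subseteq\mathbb{G}$ and $p\in\mathbb{G}$, $p\in\mathrm{cl}_\tau(S)$ iff $\{(x,p(x)):x\in\mathrm{M}(G)\}\subseteq\overline{\bigcup_{q\in S}\{(x,q(x)):x\in\mathrm{M}(G)\}}$ in $\mathrm{M}(G)\times\mathrm{M}(G)$; this is a compact T1 topology. For $\mathcal{U}\in\beta I$ and $(p_i)\in\mathbb{G}^I$, $\lim_{\mathcal{U}}p_i:=\bigcap_{S\in\mathcal{U}}\mathrm{cl}_\tau\{p_i:i\in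 S\}\subseteq\mathbb{G}$. An ultrafilter $\mathcal{V}$ on $O$ is cofinal if $\{B\in O:B\subseteq A\}\in\mathcal{V}$ for every $A\in O$. The Fubini product $\mathcal{V}\otimes\mathcal{U}\in\beta(O\times I)$ is defined by: $S\in\mathcal{V}\otimes\mathcal{U}$ iff $\{A\in O:\{i\in I:(A,i)\in S\}\in\mathcal{U}\}\in\mathcal{V}$. Ultracopowers: for a (discrete) set $J$, $J\times\mathrm{M}(G)$ is a $G$-space via $g(j,x)=(j,gx)$. $\mathrm{S}_G(J\times\mathrm{M}(G))$ denotes its universal $G$-equivariant compactification: a $G$-flow containing $J\times\mathrm{M}(G)$ as a dense $G$-subspace such that every $G$-map from $J\times\mathrm{M}(G)$ to a $G$-flow extends to a $G$-map on $\mathrm{S}_G(J\times\mathrm{M}(G))$. Let $\pi_J\colon\mathrm{S}_G(J\times\mathrm{M}(G))\to\beta J$ and $\pi\colon\mathrm{S}_G(J\times\mathrm{M}(G))\to\mathrm{M}(G)$ extend the projections. For $\mathcal{W}\in\beta J$, $\Sigma^G_{\mathcal{W}}\mathrm{M}(G):=\pi_J^{-1}(\{\mathcal{W}\})$, a $G$-flow. $M$-limits: given a set $J$ and $(q_j)_{j\in J}\in\mathbb{G}^J$, let $\phi$ be the automorphism of $\mathrm{S}_G(J\times\mathrm{M}(G))$ with $\phi(j,x)=(j,q_j(x))$. If $M\subseteq\mathrm{S}_G(J\times\mathrm{M}(G))$ is a minimal subflow, then $\pi|_M\colon M\to\mathrm{M}(G)$ is an isomorphism, and $\lim_Mq_j:=\pi\circ\phi\circ(\pi|_M)^{-1}\in\mathbb{G}$.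 In the claim this is applied with $J=O\times I$. *)

(* Defs.v *)
From HB Require Import structures.
From mathcomp Require Import all_boot all_classical topology.

Set Implicit Arguments.
Unset Strict Implicit.
Unset Printing Implicit Defensive.

Local Open Scope classical_set_scope.

HB.mixin Record Group_isTopGroup G of Group G & Topological G := {
  topgroup_mul_continuous : continuous (fun gh : G * G => (gh.1 * gh.2)%g);
  topgroup_inv_continuous : continuous (fun g : G => (g^-1)%g)
}.

#[short(type="topGroupType")]
HB.structure Definition TopGroup :=
  {G of Group G & Topological G & Group_isTopGroup G}.

HB.mixin Record isGSpace (G : topGroupType) X of Topological X := {
  gact : G -> X -> X;
  gact1 : forall x, gact 1%g x = x;
  gactM : forall g h x, gact (g * h)%g x = gact g (gact h x);
  gact_continuous : continuous (fun gx : G * X => gact gx.1 gx.2)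
}.

#[short(type="gSpaceType")]
HB.structure Definition GSpace (G : topGroupType) :=
  {X of Topological X & isGSpace G X}.

HB.mixin Record GSpace_isFlow (G : topGroupType) X of GSpace G X := {
  flow_compact : compact [set: X];
  flow_hausdorff : hausdorff_space X
}.

#[short(type="flowType")]
HB.structure Definition Flow (G : topGroupType) :=
  {X of GSpace G X & GSpace_isFlow G X}.

Section flows.
Context {G : topGroupType}.

Definition is_gmap (X Y : gSpaceType G) (f : X -> Y) :=
  continuous f /\ forall (g : G) x, f (gact g x) = gact g (f x).

Definition orbit (X : gSpaceType G) (x : X) : set X :=
  range (fun g : G => gact g x).

(* Nonemptiness is part of minimality: the empty flow has no orbits, and a
   nonempty flow has no map to it. *)
Definition minimal_flow (X : flowType G) :=
  [set: X] !=set0 /\ forall x : X, dense (orbit x).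

(* The flow N, with the subspace topology, is minimal; the last clause says
   that each orbit is dense in N. *)
Definition minimal_subflow (X : flowType G) (N : set X) :=
  [/\ N !=set0, closed N,
      forall (g : G) x, N x -> N (gact g x) &
      forall x, N x -> N `<=` closure (orbit x)].

Definition universal_minimal_flow (X : flowType G) :=
  minimal_flow X /\
  forall Y : flowType G, minimal_flow Y ->
    exists2 f : X -> Y, is_gmap f & set_surj [set: X] [set: Y] f.

Definition is_gaut (X : gSpaceType G) (f : X -> X) :=
  is_gmap f /\ exists f' : X -> X, [/\ is_gmap f', cancel f f' & cancel f' f].

Record gaut (X : gSpaceType G) := GAut {
  gaut_fun :> X -> X;
  gaut_is_gaut : is_gaut gaut_fun
}.

Definition graph (X : gSpaceType G) (p : gaut X) : set (X * X) :=
  range (fun x => (x, p x)).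

Definition cl_tau (X : flowType G) (S : set (gaut X)) : set (gaut X) :=
  [set p | graph p `<=` closure (\bigcup_(q in S) graph q)].

End flows.

(* The Stone-Cech compactification of the discrete set I. *)
Record beta (I : Type) := Beta {
  ultra :> set I -> Prop;
  ultra_ultra : UltraFilter ultra
}.
#[global] Existing Instance ultra_ultra.

HB.instance Definition _ (I : Type) := gen_eqMixin (beta I).
HB.instance Definition _ (I : Type) := gen_choiceMixin (beta I).

Section beta_topology.
Variable I : Type.

Let basic (A : set I) : set (beta I) := [set W | W A].

Let basic_cover : \bigcup_(A in setT) basic A = setT.
Proof.
by rewrite -subTset => W _; exists setT => //=; exact: filterT.
Qed.

Let basic_join (A B : set I) (W : beta I) : setT A -> setT B ->
  basic A W -> basic B W ->
  exists C, [/\ setT C, basic C W & basic C `<=` basic A `&` basic B].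
Proof.
move=> _ _ WA WB; exists (A `&` B); split => //; first exact: (@filterI _ W _ A B).
move=> W' W'AB; split.
- exact: (@filterS _ W' _ _ _ (@subIsetl _ A B)).
- exact: (@filterS _ W' _ _ _ (@subIsetr _ A B)).
Qed.

HB.instance Definition _ := isBaseTopological.Build (beta I)
  basic_cover basic_join.
End beta_topology.

(* The inclusion of I in its Stone-Cech compactification. *)
Definition principal_ultra (I : Type) (i : I) : beta I :=
  Beta (principal_filter_ultra i).

Definition ulim (G : topGroupType) (X : flowType G) (I : Type)
    (U : beta I) (p_ : I -> gaut X) : set (gaut X) :=
  \bigcap_(A in [set A | U A]) cl_tau (p_ @` A).

Section fubini.
Variables (O I : Type) (V : beta O) (U : beta I).

Definition fubini_sets (S : set (O * I)) : Prop :=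
  V [set A | U [set i | S (A, i)]].

Lemma fubini_ultra : UltraFilter fubini_sets.
Proof.
have filtI : Filter fubini_sets.
  split; rewrite /fubini_sets.
  - apply: filterE => A; exact: filterT.
  - move=> S T VS VT; apply: (@filterS _ V _ _ _ _ (@filterI _ V _ _ _ VS VT)).
    by move=> A [US UT]; exact: (@filterI _ U _ _ _ US UT).
  - by move=> S T ST; apply: filterS => A; apply: filterS => i; exact: ST.
have fF : ProperFilter fubini_sets.
  apply: Build_ProperFilter_ex => // S /(@filter_ex _ V)[A].
  by move=> /(@filter_ex _ U)[i SAi]; exists (A, i).
split=> // F FF sF; rewrite eqEsubset; split=> // S FS.
have [//|VnS] := in_ultra_setVsetC [set A | U [set i | S (A, i)]] (ultra_ultra V).
suff FnS : F (~` S) by have [? []] := @filter_ex _ F _ _ (@filterI _ F _ _ _ FS FnS).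
apply: sF; apply: (@filterS _ V _ _ _ _ VnS) => A nSA.
by have [/nSA|] := in_ultra_setVsetC [set i | S (A, i)] (ultra_ultra U).
Qed.

Definition fubini : beta (O * I) := Beta fubini_ultra.
End fubini.

(* J x X for the discrete set J, with the action on the second factor. *)
Definition dprod (J X : Type) := (J * X)%type.

HB.instance Definition _ (J : Type) (X : topologicalType) :=
  Topological.copy (dprod J X) (discrete_topology {classic J} * X)%type.

Section dprod_gspace.
Context (G : topGroupType) (J : Type) (X : gSpaceType G).

Let act (g : G) (jx : dprod J X) : dprod J X := (jx.1, gact g jx.2).

Let act1 jx : act 1%g jx = jx.
Proof. by case: jx => j x; rewrite /act/= gact1. Qed.

Let actM g h jx : act (g * h)%g jx = act g (act h jx).
Proof. by rewrite /act/= gactM. Qed.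

Let act_continuous : continuous (fun gx : G * dprod J X => act gx.1 gx.2).
Proof.
pose D := discrete_topology {classic J}.
suff : continuous (fun gx : G * (D * X) => (gx.2.1, gact gx.1 gx.2.2)) by [].
move=> [g [j x]].
have snd_cvg : (fun gx : G * (D * X) => gx.2) @ nbhs (g, (j, x)) --> nbhs (j, x).
  exact: cvg_snd.
have h1 : (fun gx : G * (D * X) => gx.2.1) @ nbhs (g, (j, x)) --> nbhs j.
  exact: (cvg_comp (fun gx : G * (D * X) => gx.2) fst snd_cvg cvg_fst).
have h2 : (fun gx : G * (D * X) => gx.2.2) @ nbhs (g, (j, x)) --> nbhs x.
  exact: (cvg_comp (fun gx : G * (D * X) => gx.2) snd snd_cvg cvg_snd).
have h3 : (fun gx : G * (D * X) => gact gx.1 gx.2.2) @ nbhs (g, (j, x)) -->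
    nbhs (gact g x).
  have h4 : (fun gx : G * (D * X) => (gx.1, gx.2.2)) @ nbhs (g, (j, x)) -->
      nbhs (g, x).
    by apply: (cvg_pair _ h2); exact: cvg_fst.
  exact: (cvg_comp _ (fun gx : G * X => gact gx.1 gx.2) h4
    (@gact_continuous _ _ (g, x))).
exact: (cvg_pair h1 h3).
Qed.

HB.instance Definition _ := isGSpace.Build G (dprod J X) act1 actM act_continuous.
End dprod_gspace.

Section compactification.
Context {G : topGroupType}.

Definition is_embedding (X Y : topologicalType) (f : X -> Y) :=
  injective f /\
  forall A : set X, open A <-> exists2 B : set Y, open B & f @^-1` B = A.

(* S, with iota as the inclusion, is the universal equivariant
   compactification of X. *)
Definition universal_compactification (X : gSpaceType G) (S : flowType G)
    (iota : X -> S) :=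
  [/\ is_gmap iota, is_embedding iota, dense (range iota) &
      forall (Y : flowType G) (f : X -> Y), is_gmap f ->
        exists2 F : S -> Y, is_gmap F & forall x, F (iota x) = f x].

Definition inverse_on (S X : Type) (N : set S) (f : S -> X) (h : X -> S) :=
  [/\ forall x, N (h x), cancel h f & forall s, N s -> h (f s) = s].

Definition is_Mlim (J : Type) (X S : flowType G) (iota : dprod J X -> S)
    (pi : S -> X) (N : set S) (q : J -> gaut X) (p : gaut X) :=
  exists (phi : S -> S) (h : X -> S),
    [/\ is_gaut phi,
        forall j x, phi (iota (j, x)) = iota (j, q j x),
        inverse_on N pi h &
        (p : X -> X) = pi \o phi \o h].

End compactification.

Definition cofinal (X : topologicalType) (w : X)
    (V : beta (set_type (open_nbhs w))) :=
  forall A : set_type (open_nbhs w),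
    V [set B : set_type (open_nbhs w) | set_val B `<=` set_val A].

(* Main.v *)
From HB Require Import structures.
Require Import Defs.
From mathcomp Require Import all_boot all_classical topology.

(** Write J for the product of the neighbourhoods of w with I, and W for the
    Fubini product of V and U on J. Let phi be the automorphism of S that
    extends ((A, i), x) |-> ((A, i), p_ i x).

    Every minimal subflow N of S is mapped isomorphically onto M by pi. By
    universality of M there is a surjection f of M onto N, so that pi \o f is
    an endomorphism of M, and endomorphisms of a universal minimal flow are
    injective ([universal_minimal_flow_inj]). For the latter, take a minimal
    left ideal L of the enveloping semigroup of M, and phi0 : M -> L given by
    universality. If l, l' in L agree at the point m, then l and l' have the
    same product with phi0 m on the right, and right translations of L are
    injective by the structure theory of compact right topological semigroups;
    hence each evaluation L -> M is injective. Elements of L commute with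
    endomorphisms of M, and this transfers injectivity from evaluations to
    endomorphisms.

    Consequently p is an M-limit along N exactly when
    pi (phi s) = p (pi s) for all s in N ([exists_Mlim]), and this is a closed
    condition, invariant under G.

    If p is the limit along some N over W, each (x, p x) is the image under
    (pi, pi \o phi) of a point of S lying over W. Such a point is approached by
    points iota ((A, i), y) with i in any prescribed member of U, whose images
    lie in the graph of p_ i ([Mlim_graph_closure]); hence p is in the
    ultralimit.

    Conversely, let p be in the ultralimit and look at the point (w, p w) of
    its graph. By cofinality, V-almost all A are as small as desired, and for
    such A every member of U contains some i with (x, p_ i x) close to (w, p w)
    for some x in A. By compactness of S there is s over W with pi s = w and
    pi (phi s) = p w ([tau_limit_point]). The closed invariant set of points s
    over W with pi (phi s) = p (pi s) is therefore nonempty, and it contains a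
    minimal subflow. *)

Local Open Scope classical_set_scope.

Set Implicit Arguments.
Unset Strict Implicit.
Unset Printing Implicit Defensive.

(* The name also belongs to the orbits of a function on a finite type. *)
Local Notation orbit := Defs.orbit.

(** * Minimal closed sets and idempotents in compact spaces *)

Lemma closed_eq_fun (X Y : topologicalType) (f g : X -> Y) :
  hausdorff_space Y -> continuous f -> continuous g ->
  closed [set x | f x = g x].
Proof.
move=> hY cf cg x clx; apply: hY => A B fxA gxB.
have nAB : nbhs x (f @^-1` A `&` g @^-1` B).
  by apply: filterI; [exact: cf | exact: cg].
have [y [/= fgy [Ay By]]] := clx _ nAB.
by exists (f y); split => //; rewrite fgy.
Qed.

Lemma dense_eq_fun (X Y : topologicalType) (D : set X) (f g : X -> Y) :
  hausdorff_space Y -> continuous f -> continuous g -> dense D ->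
  (forall x, D x -> f x = g x) -> forall x, f x = g x.
Proof.
move=> hY cf cg dD fgD x; apply: (closed_eq_fun hY cf cg) => B.
rewrite nbhsE => -[O [oO Ox] OB].
have [y [Oy Dy]] := dD O (ex_intro _ x Ox) oO.
by exists y; split; [exact: fgD | exact: OB].
Qed.

Lemma closed_image (X Y : topologicalType) (f : X -> Y) (A : set X) :
  compact [set: X] -> hausdorff_space Y -> continuous f -> closed A ->
  closed (f @` A).
Proof.
move=> cX hY cf cA; apply: compact_closed => //.
apply: continuous_compact; first exact: continuous_subspaceT.
exact: (subclosed_compact cA cX).
Qed.

(** Zorn's lemma for the complements: compactness keeps the intersection of a
    chain nonempty. It yields both minimal subflows and minimal closed
    subsemigroups. *)
Lemma exists_minimal_closed (X : topologicalType) (Q : set (set X))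
    (A : set X) :
  compact [set: X] ->
  (forall F : set (set X), F `<=` Q -> Q (\bigcap_(C in F) C)) ->
  closed A -> A !=set0 -> Q A ->
  exists B, [/\ closed B, B !=set0, Q B, B `<=` A &
    forall C, closed C -> C !=set0 -> Q C -> C `<=` B -> B `<=` C].
Proof.
move=> cX QI cA A0 QA.
pose P := [set D | [/\ closed (A `\` D), A `\` D !=set0 & Q (A `\` D)]].
have [F FP totF|D [[cD D0 QD] maxD]] := Zorn_bigcup (P := P).
  (* Adding the empty set makes the chain nonempty and keeps its union. *)
  pose F' := F `|` [set set0].
  have F'P : F' `<=` P by move=> D [/FP//|->]; rewrite /P /= setD0.
  have totF' : total_on F' subset.
    by move=> C D [FC|->] [FD|->]; [exact: totF|right|left|left].
  have AE : A `\` \bigcup_(D in F) D =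
      \bigcap_(C in [set A `\` D | D in F']) C.
    apply/seteqP; split=> [x [Ax nFx] _ [D F'D <-]|x FIx].
      split=> // Dx; case: F'D => [FD|D0]; last by rewrite D0 in Dx.
      by apply: nFx; exists D.
    split.
      by have [] : (A `\` set0) x by apply: FIx; exists set0 => //; right.
    move=> [D FD Dx].
    by have [] : (A `\` D) x by apply: FIx; exists D => //; left.
  rewrite /P /= AE; split.
  - by apply: closed_bigI => _ [D /F'P[cD _ _] <-].
  - pose B := filter_from F' (fun D => A `\` D).
    have FB : ProperFilter B.
      apply: filter_from_proper; last by move=> D /F'P[].
      apply: filter_from_filter; first by exists set0; right.
      move=> C D F'C F'D; have [CD|DC] := totF' _ _ F'C F'D.
        by exists D => //; rewrite subsetI; split => //; exact: setDS.
      by exists C => //; rewrite subsetI; split => //; exact: setDS.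
    have [x [_ clx]] := cX B FB (@filterT _ B _).
    exists x => _ [D F'D <-]; have [cD _ _] := F'P _ F'D.
    apply: cD => N Nx; by apply: clx => //; exists D.
  - by apply: QI => _ [D /F'P[_ _ QD] <-].
exists (A `\` D); split=> //.
move=> C cC C0 QC CAD x [Ax nDx].
have CE : A `\` ~` C = C by rewrite setDE setCK setIidr // => y /CAD[].
apply: contrapT => nCx; apply: (maxD (~` C)); last by rewrite /P /= CE.
by split=> [y Dy /CAD[]//|CD]; exact: (nDx (CD _ nCx)).
Qed.

(** In a minimal closed subsemigroup B every element v is idempotent: B v is a
    closed subsemigroup of B, hence all of B, so the closed subsemigroup of
    those x with x v = v is nonempty, hence all of B and contains v. *)
Lemma ellis_numakura (T : topologicalType) (op : T -> T -> T) (A : set T) :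
  compact [set: T] -> hausdorff_space T -> associative op ->
  (forall y, continuous (op^~ y)) ->
  closed A -> A !=set0 -> (forall x y, A x -> A y -> A (op x y)) ->
  exists2 v, A v & op v v = v.
Proof.
move=> cT hT opA cop cA A0 AA.
pose Q := [set B : set T | forall x y, B x -> B y -> B (op x y)].
have [|B [cB [v Bv] QB BA minB]] := @exists_minimal_closed _ Q A cT _ cA A0 AA.
  move=> F FQ x y Fx Fy C FC; exact: (FQ _ FC _ _ (Fx _ FC) (Fy _ FC)).
exists v; first exact: BA.
have Bvv : B `<=` op^~ v @` B.
  apply: minB.
  - exact: closed_image.
  - by exists (op v v), v.
  - move=> _ _ [x Bx <-] [y By <-]; exists (op (op x v) y).
      exact: (QB _ _ (QB _ _ Bx Bv) By).
    by rewrite !opA.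
  - by move=> _ [x Bx <-]; exact: QB.
have [x Bx xvv] := Bvv _ Bv.
have BC : B `<=` B `&` [set x | op x v = v].
  apply: minB; last by move=> y [].
  - apply: closedI => //.
    by apply: (closed_eq_fun hT (cop v)) => y; exact: cvg_cst.
  - by exists x.
  - move=> y z [By yv] [Bz zv]; split; first exact: QB.
    by rewrite /= -opA zv.
by have [] := BC _ Bv.
Qed.

(** * Minimal subflows *)

Section minimal_subflows.
Context {G : topGroupType}.
Implicit Types X Y : flowType G.

Definition ginvariant X (A : set X) := forall (g : G) x, A x -> A (gact g x).

Lemma gact_cont (X : gSpaceType G) (g : G) : continuous (gact g : X -> X).
Proof.
move=> x.
apply: (@cvg_comp _ _ _ (fun y : X => (g, y))
   (fun gx : G * X => gact gx.1 gx.2) _ (nbhs (g, x))).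
  by apply: cvg_pair; [exact: cvg_cst | exact: cvg_id].
exact: (@gact_continuous _ _ (g, x)).
Qed.

Lemma orbit_self X (x : X) : orbit x x.
Proof. by exists 1%g => //; rewrite gact1. Qed.

Lemma invariant_closure_orbit X (x : X) : ginvariant (closure (orbit x)).
Proof.
move=> g y cly B /gact_cont /cly[_ [[h _ <-] Bgh]].
by exists (gact g (gact h x)); split => //; exists (g * h)%g; rewrite ?gactM.
Qed.

Lemma minimal_subflow_sub X (N A : set X) : minimal_subflow N ->
  closed A -> ginvariant A -> A !=set0 -> A `<=` N -> N `<=` A.
Proof.
move=> [_ _ _ Nmin] cA iA [x Ax] AN y /(Nmin _ (AN _ Ax)) cly.
by apply: cA; apply: closureS cly => _ [g _ <-]; exact: iA.
Qed.

Lemma exists_minimal_subflow X (A : set X) :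
  closed A -> ginvariant A -> A !=set0 ->
  exists2 N, minimal_subflow N & N `<=` A.
Proof.
move=> cA iA A0.
have [|N [cN N0 iN NA Nmin]] :=
    @exists_minimal_closed _ (@ginvariant X) A flow_compact _ cA A0 iA.
  by move=> F FQ g x Fx C FC; apply: FQ => //; exact: Fx.
exists N => //; split => // x Nx; apply: Nmin.
- exact: closed_closure.
- by exists x; apply: subset_closure; exact: orbit_self.
- exact: invariant_closure_orbit.
- by move=> y cly; apply: cN; apply: closureS cly => _ [g _ <-]; exact: iN.
Qed.

Lemma gmap_image_minimal X Y (f : X -> Y) (N : set X) : minimal_flow Y ->
  is_gmap f -> closed N -> ginvariant N -> N !=set0 -> f @` N = setT.
Proof.
move=> [_ Ymin] [cf fg] cN iN [x Nx]; apply/seteqP; split=> // y _.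
have cfN : closed (f @` N).
  by apply: closed_image => //; [exact: flow_compact|exact: flow_hausdorff].
apply: cfN => B; rewrite nbhsE => -[O [oO Oy] OB].
have [z [Oz [g _ gz]]] := Ymin (f x) O (ex_intro _ y Oy) oO.
rewrite -{z}gz in Oz.
exists (gact g (f x)); split; last exact: OB.
by exists (gact g x); [exact: iN | rewrite fg].
Qed.

(** A bundle, so that the flow structure on its points can be inferred. *)
Record subflow (X : flowType G) := Subflow {
  carrier :> set X;
  carrier_closed : closed carrier;
  carrier_invariant : ginvariant carrier
}.


Definition subflow_type (X : flowType G) (N : subflow X) :=
  set_type (carrier N).
End minimal_subflows.

HB.instance Definition _ (G : topGroupType) (X : flowType G) (N : subflow X) :=
  Topological.copy (subflow_type N) (set_type (carrier N)).

Lemma continuous_to_subtype (T X : topologicalType) (A : set X)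
    (f : T -> set_type A) :
  continuous (fun t => set_val (f t)) -> continuous f.
Proof.
move=> cf; apply/continuousP => _ [B oB <-]; rewrite -comp_preimage.
by move/continuousP: cf; apply.
Qed.

Lemma continuous_subtype_val (X : topologicalType) (A : set X) :
  continuous (set_val : set_type A -> X).
Proof. exact: initial_continuous. Qed.

Section subflow_flow.
Context (G : topGroupType) (X : flowType G) (N : subflow X).

Let act (g : G) (x : subflow_type N) : subflow_type N :=
  exist _ (gact g (set_val x)) (mem_set (carrier_invariant g (set_valP x))).

Let act1 x : act 1%g x = x.
Proof. by apply: val_inj; rewrite /act /= gact1. Qed.

Let actM g h x : act (g * h)%g x = act g (act h x).
Proof. by apply: val_inj; rewrite /act /= gactM. Qed.

Let act_continuous :
  continuous (fun gx : G * subflow_type N => act gx.1 gx.2).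
Proof.
apply: (@continuous_to_subtype (G * subflow_type N)%type) => -[g x].
apply: (@cvg_comp _ _ _ (fun gx : G * subflow_type N => (gx.1, set_val gx.2))
   (fun gx : G * X => gact gx.1 gx.2) _ (nbhs (g, set_val x))).
  apply: cvg_pair; first exact: cvg_fst.
  apply: (@cvg_comp _ _ _ snd (set_val : subflow_type N -> X) _ (nbhs x)).
    exact: cvg_snd.
  exact: continuous_subtype_val.
exact: (@gact_continuous _ _ (g, set_val x)).
Qed.

HB.instance Definition _ :=
  isGSpace.Build G (subflow_type N) act1 actM act_continuous.

Let sub_compact : compact [set: subflow_type N].
Proof.
move=> F FF _; 
have cN : compact (carrier N).
  exact: subclosed_compact (@carrier_closed _ _ N) (@flow_compact _ X) _.
have FvF : ProperFilter (set_val @ F) by exact: fmap_proper_filter.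
have [|x [Nx clx]] := cN (set_val @ F) FvF.
  by apply: (filterE (F := F)) => y; exact: set_valP.
exists (exist _ x (mem_set Nx)); split => // A B FA.
rewrite nbhsE => -[_ [[C oC <-] Cx] CB].
have [_ [[y Ay <-] Cy]] : (set_val @` A) `&` C !=set0.
  apply: clx; last exact: open_nbhs_nbhs.
  apply: (@filterS _ F _ A) FA => y Ay; by exists y.
by exists y; split => //; exact: CB.
Qed.

Let sub_hausdorff : hausdorff_space (subflow_type N).
Proof.
move=> x y clxy; apply: val_inj; apply: flow_hausdorff => A B xA yB.
have [z [Az Bz]] := clxy _ _ (@continuous_subtype_val _ _ x _ xA)
  (@continuous_subtype_val _ _ y _ yB).
by exists (set_val z).
Qed.

HB.instance Definition _ :=
  GSpace_isFlow.Build G (subflow_type N) sub_compact sub_hausdorff.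

Lemma minimal_subflow_type : minimal_subflow (carrier N) ->
  minimal_flow (subflow_type N).
Proof.
move=> [[x Nx] _ _ Nmin]; split; first by exists (exist _ x (mem_set Nx)).
move=> y O [z Wz] [W oW WO]; move: Wz; rewrite -{}WO => Wz.
have nW : nbhs (set_val z) W by apply: open_nbhs_nbhs; split.
have [_ [[g _ <-] Wg]] := Nmin _ (set_valP y) _ (set_valP z) _ nW.
by exists (gact g y); split => //; exists g.
Qed.
End subflow_flow.

Section universal_maps.
Context {G : topGroupType}.

(** Universality quantifies over flows that are types; this transports it to
    minimal subsets of a given flow. *)
Lemma universal_onto_minimal_subflow (M X : flowType G) (N : set X) :
  universal_minimal_flow M -> minimal_subflow N ->
  exists2 f : M -> X, is_gmap f & range f = N.
Proof.
move=> [_ univM] minN; have [_ cN iN _] := minN.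
pose N' := Subflow cN iN.
have [f [cf fg] fN] := univM _ (@minimal_subflow_type _ _ N' minN).
exists (fun x => set_val (f x)).
  split=> [x|g x]; last by rewrite fg.
  exact: (cvg_comp f set_val (cf x) (@continuous_subtype_val _ _ (f x))).
apply/seteqP; split=> [_ [x _ <-]|x Nx]; first exact: set_valP.
have [y _ fy] := fN (exist _ x (mem_set Nx)) I.
by exists y => //; rewrite fy.
Qed.

End universal_maps.

(** * The flow of self-maps and its enveloping semigroup *)

Definition selfmaps (X : Type) := prod_topology (fun _ : X => X).

HB.instance Definition _ (X : topologicalType) :=
  Topological.copy (selfmaps X) (prod_topology (fun _ : X => X)).

Section selfmaps_topology.
Variable X : topologicalType.

Lemma continuous_eval (x : X) : continuous (fun f : selfmaps X => f x).
Proof. exact: (@proj_continuous X (fun=> X) x). Qed.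

Lemma continuous_to_selfmaps (T : topologicalType) (F : T -> selfmaps X) :
  (forall x, continuous (fun t => F t x)) -> continuous F.
Proof.
move=> cF t; apply/cvg_sup => x U [_ [[W oW <-] WF WU]].
apply: (@filterS _ _ _ (F @^-1` (fun f => W (f x)))).
  by move=> u; exact: WU.
by apply: (cF x t); exact: open_nbhs_nbhs.
Qed.

Lemma selfmaps_compact : compact [set: X] -> compact [set: selfmaps X].
Proof.
move=> cX; have := @tychonoff X (fun=> X) (fun=> setT) (fun=> cX).
by congr compact; apply/seteqP.
Qed.

Lemma selfmaps_hausdorff : hausdorff_space X -> hausdorff_space (selfmaps X).
Proof. by move=> hX; apply: (@hausdorff_product X (fun=> X)). Qed.

Definition selfmaps_comp (f g : selfmaps X) : selfmaps X := f \o g.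

Lemma continuous_precomp (q : selfmaps X) : continuous (selfmaps_comp^~ q).
Proof. by apply: continuous_to_selfmaps => x; exact: continuous_eval. Qed.
End selfmaps_topology.

Section selfmaps_flow.
Context (G : topGroupType) (X : flowType G).

Let act (g : G) (f : selfmaps X) : selfmaps X := fun x => gact g (f x).

Let act1 f : act 1%g f = f.
Proof. by apply: funext => x; rewrite /act gact1. Qed.

Let actM g h f : act (g * h)%g f = act g (act h f).
Proof. by apply: funext => x; rewrite /act gactM. Qed.

Let act_continuous : continuous (fun gf : G * selfmaps X => act gf.1 gf.2).
Proof.
apply: continuous_to_selfmaps => x [g f].
apply: (@cvg_comp _ _ _ (fun gf : G * selfmaps X => (gf.1, gf.2 x))
   (fun gx : G * X => gact gx.1 gx.2) _ (nbhs (g, f x))).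
  apply: cvg_pair; first exact: cvg_fst.
  apply: (@cvg_comp _ _ _ snd (fun f : selfmaps X => f x) _ (nbhs f)).
    exact: cvg_snd.
  exact: continuous_eval.
exact: (@gact_continuous _ _ (g, f x)).
Qed.

HB.instance Definition _ :=
  isGSpace.Build G (selfmaps X) act1 actM act_continuous.

HB.instance Definition _ := GSpace_isFlow.Build G (selfmaps X)
  (selfmaps_compact flow_compact) (selfmaps_hausdorff flow_hausdorff).
End selfmaps_flow.

Section enveloping_semigroup.
Context (G : topGroupType) (M : flowType G).

(** The Ellis semigroup: the identity has as orbit the set of all translations
    x |-> g x, and the closure is pointwise. *)
Definition enveloping : set (selfmaps M) := closure (orbit (id : selfmaps M)).

Lemma envelopingW (C : set (selfmaps M)) : closed C ->
  (forall g : G, C (gact g)) -> enveloping `<=` C.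
Proof.
move=> cC gC e Ee; apply: cC; apply: closureS Ee => _ [g _ <-]; exact: gC.
Qed.

(** Both sides are continuous in e, and they agree when e is a translation. *)
Lemma gmap_enveloping (f : M -> M) (e : selfmaps M) (x : M) :
  is_gmap f -> enveloping e -> f (e x) = e (f x).
Proof.
move=> [cf fg]; move: e; apply: envelopingW; last by move=> g; exact: fg.
apply: closed_eq_fun; [exact: flow_hausdorff| |exact: continuous_eval].
by move=> e; apply: (cvg_comp _ f (@continuous_eval _ x e)); exact: cf.
Qed.

(** The analogue for maps to self-maps, where e acts by composition on the
    left because G does. *)
Lemma gmap_selfmaps_enveloping (f : M -> selfmaps M) (e : selfmaps M) (x : M) :
  is_gmap f -> enveloping e -> f (e x) = selfmaps_comp e (f x).
Proof.
move=> [cf fg]; move: e; apply: envelopingW; last by move=> g; exact: fg.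
apply: closed_eq_fun.
- exact: flow_hausdorff.
- by move=> e; apply: (cvg_comp _ f (@continuous_eval _ x e)); exact: cf.
- exact: continuous_precomp.
Qed.

Section minimal_left_ideal.
Variable L : set (selfmaps M).
Hypothesis minL : minimal_subflow L.
Hypothesis LE : L `<=` enveloping.

Let op := @selfmaps_comp M.

(** Stability under G passes to its closure, since e |-> e x is continuous:
    minimal subflows of the enveloping semigroup are left ideals. *)
Lemma ideal_mul e x : enveloping e -> L x -> L (op e x).
Proof.
have [_ cL iL _] := minL.
move=> + Lx; move: e; apply: envelopingW; last by move=> g; exact: iL.
by move/continuous_closedP: (@continuous_precomp M x); apply.
Qed.

(** L q is a nonempty closed invariant subset of L. *)
Lemma ideal_mul_onto q x : L q -> L x -> exists2 y, L y & op y q = x.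
Proof.
have [L0 cL iL _] := minL.
move=> Lq; move: x; suff : L `<=` op^~ q @` L by [].
apply: (minimal_subflow_sub minL).
- apply: closed_image cL; [exact: flow_compact | exact: flow_hausdorff |].
  exact: continuous_precomp.
- by move=> g _ [y Ly <-]; exists (gact g y) => //; exact: iL.
- by have [y Ly] := L0; exists (op y q), y.
- by move=> _ [y Ly <-]; apply: ideal_mul => //; exact: LE.
Qed.

(** There is an idempotent v with v q = q, by Ellis-Numakura applied to the
    stabilizer of q, and it is a right identity of L = L v. Solving r q = v and
    s r = v gives q = v q = s r q = s v = s, so q r = v: right translation by r
    undoes right translation by q. *)
Lemma ideal_mul_right_inj q x y : L q -> L x -> L y ->
  op x q = op y q -> x = y.
Proof.
move=> Lq Lx Ly xyq; have [_ cL _ _] := minL.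
have [v [Lv vq] vv] : exists2 v, (L `&` [set v | op v q = q]) v & op v v = v.
  apply: ellis_numakura => //.
  - exact: flow_compact.
  - exact: flow_hausdorff.
  - exact: continuous_precomp.
  - apply: closedI => //; apply: (closed_eq_fun (f := op^~ q)).
    + exact: flow_hausdorff.
    + exact: continuous_precomp.
    + exact: cst_continuous.
  - by have [v Lv vq] := ideal_mul_onto Lq Lq; exists v.
  - move=> a b [La aq] [Lb bq]; split.
      by apply: ideal_mul => //; exact: LE.
    by rewrite /= -[in RHS]aq -[in RHS]bq.
have Lv_id z : L z -> op z v = z.
  by move=> /(ideal_mul_onto Lv)[t Lt <-]; rewrite -[in RHS]vv.
have [r Lr rq] := ideal_mul_onto Lq Lv.
have [s Ls sr] := ideal_mul_onto Lr Lv.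
have qE : q = s.
  by rewrite -vq -sr -[RHS](Lv_id _ Ls) -rq.
by rewrite -(Lv_id _ Lx) -(Lv_id _ Ly) -sr -qE -[LHS]/(op (op x q) r) xyq.
Qed.
End minimal_left_ideal.

(** Coalescence of the universal minimal flow. Fixing x, every point of M is
    l x for some l in a minimal left ideal L. If f (l x) = f (l' x), then
    l (f x) = l' (f x), and evaluation at f x is injective on L. *)
Lemma universal_minimal_flow_inj (f : M -> M) :
  universal_minimal_flow M -> is_gmap f -> injective f.
Proof.
move=> univM gf.
have [|||L minL LE] := @exists_minimal_subflow _ (selfmaps M) enveloping.
- exact: closed_closure.
- exact: invariant_closure_orbit.
- by exists id; apply: subset_closure; exact: orbit_self.
have [phi gphi phiL] := universal_onto_minimal_subflow univM minL.
have [minM _] := univM; have [L0 cL iL _] := minL.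
have eval_inj m l l' : L l -> L l' -> l m = l' m -> l = l'.
  move=> Ll Ll' lm; apply: (ideal_mul_right_inj minL LE (q := phi m)) => //.
    by rewrite -phiL; exists m.
  by rewrite -!gmap_selfmaps_enveloping ?lm//; exact: LE.
have eval_onto m x : exists2 l, L l & l m = x.
  have evg : is_gmap (fun l : selfmaps M => l m).
    by split=> //; exact: continuous_eval.
  have : setT x by [].
  by rewrite -(gmap_image_minimal minM evg cL iL L0) => -[l Ll <-]; exists l.
move=> x y; have [l Ll <-] := eval_onto x x; have [l' Ll' <-] := eval_onto x y.
rewrite (gmap_enveloping _ gf (LE _ Ll)) (gmap_enveloping _ gf (LE _ Ll')).
by move=> /(eval_inj _ _ _ Ll Ll') ->.
Qed.
End enveloping_semigroup.

(** A surjection M -> N composed with pi is an injective endomorphism of M, so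
    pi is injective on N; it is onto because M is minimal. *)
Lemma minimal_subflow_section (G : topGroupType) (M S : flowType G)
    (pi : S -> M) (N : set S) :
  universal_minimal_flow M -> is_gmap pi -> minimal_subflow N ->
  exists h, inverse_on N pi h.
Proof.
move=> univM [cpi pig] minN; have [minM _] := univM.
have [N0 cN iN _] := minN.
have [f [cf fg] fN] := universal_onto_minimal_subflow univM minN.
have gpif : is_gmap (pi \o f).
  split=> [x|g x]; last by rewrite /= fg pig.
  exact: (cvg_comp f pi (cf x) (cpi _)).
have pif_inj := universal_minimal_flow_inj univM gpif.
have piN x : exists s, N s /\ pi s = x.
  have : setT x by [].
  rewrite -(gmap_image_minimal minM (conj cpi pig) cN iN N0) => -[s].
  by exists s.
have [h hP] := choice piN.
exists h; split=> [x|x|s Ns]; [by have [] := hP x|by have [] := hP x|].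
have [Nh pih] := hP (pi s); move: Nh pih Ns.
rewrite -fN => -[x _ <-] pifx [y _ ys]; rewrite -ys in pifx *.
by rewrite (pif_inj _ _ pifx).
Qed.

(** * The space of ultrafilters *)

Section beta_space.
Variable J : Type.

Lemma open_beta_basic (A : set J) : open [set W : beta J | W A].
Proof. by exists [set A] => //; rewrite bigcup_set1. Qed.

(** Ultrafilters are maximal, so an inclusion suffices. *)
Lemma beta_eq (U V : beta J) : (forall A, U A -> V A) -> U = V.
Proof.
case: U V => [U uU] [V uV] /= UV.
have VU : V = U by apply: (@max_filter _ _ uU).
by move: uV; rewrite {}VU => uV; rewrite (Prop_irrelevance uU uV).
Qed.

Lemma beta_hausdorff : hausdorff_space (beta J).
Proof.
move=> U V clUV; apply: beta_eq => A UA.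
have [//|VnA] := in_ultra_setVsetC A (ultra_ultra V).
have [W [WA WnA]] :
    [set W : beta J | W A] `&` [set W : beta J | W (~` A)] !=set0.
  by apply: clUV; apply: open_nbhs_nbhs; split => //; exact: open_beta_basic.
by have [? []] := filter_ex (filterI WA WnA).
Qed.
End beta_space.

(** * Flows over the space of ultrafilters *)

Section ultracopower.
Context (G : topGroupType) (M S : flowType G) (J : Type).
Variable iota : dprod J M -> S.
Hypothesis univS : universal_compactification iota.

Let iota_gmap : is_gmap iota. Proof. by have [] := univS. Qed.

Lemma dense_iota_eq (Y : topologicalType) (f g : S -> Y) :
  hausdorff_space Y -> continuous f -> continuous g ->
  (forall j x, f (iota (j, x)) = g (iota (j, x))) -> forall s, f s = g s.
Proof.
move=> hY cf cg fg; have [_ _ dS _] := univS.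
by apply: (dense_eq_fun hY cf cg dS) => _ [[j x] _ <-].
Qed.

Lemma fibrewise_gmap (q : J -> M -> M) : (forall j, is_gmap (q j)) ->
  is_gmap (fun jx : dprod J M => (jx.1, q jx.1 jx.2) : dprod J M).
Proof.
move=> gq; split; last by move=> g [j x] /=; congr (_, _); exact: (gq j).2.
pose D := discrete_topology {classic J}.
suff : continuous (fun jx : D * M => (jx.1, q jx.1 jx.2)) by [].
move=> [j x].
have cvg1 : fst @ nbhs ((j, x) : D * M) --> nbhs j by exact: cvg_fst.
suff cvg2 : (fun jx : D * M => q jx.1 jx.2) @ nbhs (j, x) --> nbhs (q j x).
  exact: (cvg_pair cvg1 cvg2).
move=> B /((gq j).1 x) Bx; exists ([set j], q j @^-1` B).
  by split => //; exact: discrete_set1.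
by move=> [k y] [/= -> By].
Qed.

Lemma fibrewise_extension (q : J -> M -> M) : (forall j, is_gmap (q j)) ->
  exists2 F : S -> S, is_gmap F & forall j x, F (iota (j, x)) = iota (j, q j x).
Proof.
move=> /fibrewise_gmap[cq qg]; have [_ _ _ ext] := univS.
have [|F gF FE] := ext S (fun jx => iota (jx.1, q jx.1 jx.2)).
  have [ci ig] := iota_gmap; split=> [jx|g jx].
    exact: (cvg_comp _ iota (cq jx) (ci _)).
  by rewrite -ig -qg.
by exists F => // j x; rewrite FE.
Qed.

Lemma fibrewise_automorphism (q : J -> gaut M) :
  exists2 phi : S -> S, is_gaut phi &
    forall j x, phi (iota (j, x)) = iota (j, q j x).
Proof.
have [q' q'P] := choice (fun j => (gaut_is_gaut (q j)).2).
have [phi gphi phiE] := fibrewise_extension (fun j => (gaut_is_gaut (q j)).1).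
have [psi gpsi psiE] :=
  fibrewise_extension (fun j => let: And3 g _ _ := q'P j in g).
have comp_id (F F' : S -> S) : is_gmap F -> is_gmap F' ->
    (forall j x, F' (F (iota (j, x))) = iota (j, x)) -> cancel F F'.
  move=> [cF _] [cF' _] FF'; apply: dense_iota_eq => //.
  - exact: flow_hausdorff.
  - by move=> s; exact: (cvg_comp F F' (cF s) (cF' _)).
  - by move=> s; exact: cvg_id.
exists phi => //; split=> //; exists psi; split=> //; apply: comp_id => // j x.
  by have [_ qK _] := q'P j; rewrite phiE psiE qK.
by have [_ _ q'K] := q'P j; rewrite psiE phiE q'K.
Qed.

Variable piJ : S -> beta J.
Hypothesis cont_piJ : continuous piJ.
Hypothesis piJ_iota : forall j x, piJ (iota (j, x)) = principal_ultra j.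

Lemma piJ_invariant g s : piJ (gact g s) = piJ s.
Proof.
move: s; apply: (dense_iota_eq (f := fun s => piJ (gact g s))) => //.
- exact: beta_hausdorff.
- by move=> s; apply: (@continuous_comp S S (beta J) (gact g) piJ);
    [exact: gact_cont | exact: cont_piJ].
- by move=> j x; rewrite -(proj2 iota_gmap) !piJ_iota.
Qed.

(** The points of S whose ultrafilter contains B form an open set, and the
    range of iota is dense in it. *)
Lemma fibre_approx (B : set J) (s : S) (O : set S) : piJ s B -> nbhs s O ->
  exists j x, B j /\ O (iota (j, x)).
Proof.
move=> sB; have [_ _ dS _] := univS.
rewrite nbhsE => -[O' [oO' O's] O'O].
have [t [[O't tB] [[j x] _ jxt]]] :
    (O' `&` [set t | piJ t B]) `&` range iota !=set0.
  apply: dS; first by exists s.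
  apply: openI => //; move/continuousP: cont_piJ => /(_ _ (open_beta_basic B)).
  exact.
move: O't tB; rewrite -{}jxt /= piJ_iota => /O'O Ojx jB.
by exists j, x; split => //; apply: jB.
Qed.

(** The point (x, p x) is the image of h x under (pi, pi \o phi), and points
    iota (j, y) near h x with j in B have images (y, q j y). *)
Lemma Mlim_graph_closure (U : beta J) (pi : S -> M) (N : set S)
    (q : J -> gaut M) (p : gaut M) (B : set J) :
  is_gmap pi -> (forall j x, pi (iota (j, x)) = x) ->
  N `<=` piJ @^-1` [set U] -> is_Mlim iota pi N q p -> U B ->
  graph p `<=` closure (\bigcup_(j in B) graph (q j)).
Proof.
move=> [cpi _] pi_iota NU [phi [h [[[cphi _] _] phiE [Nh pih _] pE]]] UB.
move=> _ [x _ <-] A xpA.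
have hxB : piJ (h x) B by rewrite (NU _ (Nh x)).
have cF : continuous (fun s => (pi s, pi (phi s))).
  move=> s; apply: cvg_pair; first exact: cpi.
  by apply: (@continuous_comp S S M phi pi); [exact: cphi | exact: cpi].
have [j [y [Bj Ajy]]] : exists j y, B j /\
    ((fun s => (pi s, pi (phi s))) @^-1` A) (iota (j, y)).
  by apply: fibre_approx hxB _; apply: cF; rewrite pih; move: xpA; rewrite pE.
move: Ajy; rewrite /= phiE !pi_iota => Ajy.
by exists (y, q j y); split => //; exists j => //; exists y.
Qed.

(** Compactness turns approximate solutions into a point of S: the last
    hypothesis makes the sets of those iota (j, x) with j in B and (x, q j x)
    in E a filter base, and an ultrafilter refining it converges. *)
Lemma tau_limit_point (U : beta J) (pi : S -> M) (phi : S -> S)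
    (q : J -> gaut M) (z : M * M) :
  continuous pi -> (forall j x, pi (iota (j, x)) = x) ->
  continuous phi -> (forall j x, phi (iota (j, x)) = iota (j, q j x)) ->
  (forall B E, U B -> nbhs z E -> exists j x, B j /\ E (x, q j x)) ->
  exists s, [/\ piJ s = U, pi s = z.1 & pi (phi s) = z.2].
Proof.
move=> cpi pi_iota cphi phiE zU.
pose base (BE : set J * set (M * M)) : set S :=
  [set s | exists j x, [/\ BE.1 j, BE.2 (x, q j x) & s = iota (j, x)]].
pose F := filter_from [set BE | U BE.1 /\ nbhs z BE.2] base.
have FF : ProperFilter F.
  apply: filter_from_proper; last first.
    move=> [B E] [/= UB zE]; have [j [x [Bj Ex]]] := zU _ _ UB zE.
    by exists (iota (j, x)), j, x.
  apply: filter_from_filter.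
    by exists (setT, setT); split; exact: filterT.
  move=> [B E] [B' E'] [/= UB zE] [/= UB' zE'].
  exists (B `&` B', E `&` E'); first by split; exact: filterI.
  by move=> s [j [x [[Bj B'j] [Ex E'x] ->]]]; split; exists j, x.
have [K [uK FK]] := ultraFilterLemma FF.
have cS := @flow_compact _ S; rewrite compact_ultra in cS.
have [s [_ Ks]] := cS K uK filterT.
have piE : pi s = z.1.
  apply: (@cvg_unique M (@flow_hausdorff _ M) (pi @ K)) => /=.
    exact: cvg_trans (cvg_app pi Ks) (cpi s).
  move=> E zE; apply: FK; exists (setT, fst @^-1` E).
    by split; [exact: filterT | exact: cvg_fst].
  by move=> _ [j [x [_ /= Ex ->]]]; rewrite /= pi_iota.
have phisE : pi (phi s) = z.2.
  apply: (@cvg_unique M (@flow_hausdorff _ M) ((pi \o phi) @ K)) => /=.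
    apply: (cvg_trans (cvg_app (pi \o phi) Ks)).
    by apply: (@continuous_comp S S M phi pi); [exact: cphi | exact: cpi].
  move=> E zE; apply: FK; exists (setT, snd @^-1` E).
    by split; [exact: filterT | exact: cvg_snd].
  by move=> _ [j [x [_ /= Ex ->]]]; rewrite /= phiE pi_iota.
have piJ_cvg : piJ @ K --> piJ s.
  by apply: (cvg_trans (cvg_app piJ Ks)); exact: cont_piJ.
exists s; split => //.
apply: (@cvg_unique _ (@beta_hausdorff J) (piJ @ K)) => //=.
move=> A [_ [[D _ <-] [B DB UB] DA]]; apply: FK; exists (B, setT).
  by split => //; exact: filterT.
move=> _ [j [x [/= Bj _ ->]]]; apply: DA; exists B => //.
by rewrite piJ_iota; apply/principal_filterP.
Qed.

(** The equation pi (phi t) = p (pi t) at one point propagates to a closed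
    invariant set, hence to a minimal subflow, where it says that the limit is
    p. *)
Lemma exists_Mlim (U : beta J) (pi : S -> M) (phi : S -> S)
    (q : J -> gaut M) (p : gaut M) (s : S) :
  universal_minimal_flow M -> is_gmap pi ->
  is_gaut phi -> (forall j x, phi (iota (j, x)) = iota (j, q j x)) ->
  piJ s = U -> pi (phi s) = p (pi s) ->
  exists N, [/\ minimal_subflow N, N `<=` piJ @^-1` [set U] &
    is_Mlim iota pi N q p].
Proof.
move=> univM gpi gphi phiE sU sp.
have [cpi pig] := gpi; have [[cphi phig] _] := gphi.
have [[cp pg] _] := gaut_is_gaut p.
pose T := [set t | piJ t = U] `&` [set t | pi (phi t) = p (pi t)].
have [|||N minN NT] := @exists_minimal_subflow _ S T.
- apply: closedI; apply: closed_eq_fun => //.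
  + exact: beta_hausdorff.
  + exact: cst_continuous.
  + exact: flow_hausdorff.
  + by move=> t; apply: (@continuous_comp S S M phi pi);
      [exact: cphi | exact: cpi].
  + by move=> t; apply: (@continuous_comp S M M pi p);
      [exact: cpi | exact: cp].
- move=> g t [tU tp]; split; first by rewrite /= piJ_invariant.
  by rewrite /= phig !pig pg tp.
- by exists s.
exists N; split=> //; first by move=> t /NT[].
have [h hP] := minimal_subflow_section univM gpi minN.
exists phi, h; split=> //; apply: funext => x /=.
by have [Nh pih _] := hP; have [_ /= ->] := NT _ (Nh x); rewrite pih.
Qed.
End ultracopower.

Unset Implicit Arguments.

Theorem theorem8p16 (G : topGroupType) (hausG : hausdorff_space G)
    (M : flowType G) (univM : universal_minimal_flow M)
    (w : M) (V : beta (set_type (open_nbhs w))) (cofV : cofinal V)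
    (I : Type) (U : beta I) (p_ : I -> gaut M)
    (S : flowType G) (iota : dprod (set_type (open_nbhs w) * I) M -> S)
    (univS : universal_compactification iota)
    (piJ : S -> beta (set_type (open_nbhs w) * I))
    (cont_piJ : continuous piJ)
    (piJ_iota : forall Ai x, piJ (iota (Ai, x)) = principal_ultra Ai)
    (pi : S -> M) (gmap_pi : is_gmap pi)
    (pi_iota : forall Ai x, pi (iota (Ai, x)) = x)
    (p : gaut M) :
  ulim U p_ p <->
  exists N : set S,
    [/\ minimal_subflow N,
        N `<=` piJ @^-1` [set fubini V U] &
        is_Mlim iota pi N (fun Ai => p_ Ai.2) p].
Proof.
split=> [plim|[N [_ NW limp]] B UB].
- have [phi gphi phiE] := fibrewise_automorphism univS (fun Ai => p_ Ai.2).
  have [[cphi _] _] := gphi; have [cpi _] := gmap_pi.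
  have [|s [sW sw sp]] := tau_limit_point (U := fubini V U) (z := (w, p w))
    cont_piJ piJ_iota cpi pi_iota cphi phiE.
    move=> B E WB [[A D] /= [wA pD] ADE].
    move: wA; rewrite nbhsE => -[A' wA' A'A].
    (* Cofinality of V: almost all neighbourhoods C of w lie inside A'. *)
    have [C [CA' UC]] :=
      filter_ex (filterI (cofV (exist _ A' (mem_set wA'))) WB).
    have wC : nbhs w (set_val C) by exact: open_nbhs_nbhs (set_valP C).
    have gw : graph p (w, p w) by exists w.
    have := plim _ UC _ gw (set_val C `*` D).
    case=> [|_ [[_ [i BCi <-] [x _ <-]] [Cx Dpx]]].
      by exists (set_val C, D).
    by exists (C, i), x; split => //; apply: ADE; split => //; exact/A'A/CA'.
  apply: (exists_Mlim univS cont_piJ piJ_iota univM gmap_pi gphi phiE sW).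
  by rewrite sp sw.
- move=> y /(Mlim_graph_closure univS cont_piJ piJ_iota gmap_pi pi_iota NW limp
      (B := [set Ai | B Ai.2])) cly.
  have /cly : fubini V U [set Ai | B Ai.2].
    by rewrite /= /fubini_sets; apply: filterE => A.
  apply: closureS => _ [[A i] /= Bi [x _ <-]].
  by exists (p_ i); [exists i | exists x].
Qed.
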